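(* Let $r,k\in\mathbb{Z}$ and let $n\ge 0$ be an integer. Then, as polynomials in $x$, $$\begin{aligned}A_{n+1}^{(r,k)}(x)={}&-xA_{n}^{(r,k)}(x+1)+r\sum_{m=0}^{n}\sum_{l=0}^{m}\sum_{a=0}^{m-l}\frac{(-1)^{a}\binom{m}{l}\binom{m-l}{a}}{(a+2)(a+1)(l+1)^{k}}\,S_{1}(n,m)\,B_{m-l-a}^{(1-r)}(-x)\\&+\sum_{m=0}^{n}\sum_{a=0}^{m}\binom{m}{a}\frac{S_{1}(n,m)}{(a+2)^{k}}\,B_{m-a}^{(-r)}(-x-1).\end{aligned}$$
   Context: All generating functions are formal power series in $t$. For $k\in\mathbb{Z}$, put $\mathrm{Lif}_k(t)=\sum_{n\ge 0}\frac{t^n}{n!(n+1)^k}$. For $r,k\in\mathbb{Z}$, the polynomials $A_n^{(r,k)}(x)\in\mathbb{C}[x]$ are defined by $$\left(\frac{t}{\log(1+t)}\right)^{r}\frac{\mathrm{Lif}_k(\log(1+t))}{(1+t)^{x}}=\sum_{n\ge 0}A_n^{(r,k)}(x)\frac{t^n}{n!}.$$ For $\alpha\in\mathbb{Z}$ (possibly negative or zero), the Bernoulli polynomials of order $\alpha$ are defined by $\left(\frac{t}{e^t-1}\right)^{\alpha}e^{xt}=\sum_{n\ge 0}B_n^{(\alpha)}(x)\frac{t^n}{n!}$. $S_1(n,m)$ is the (signed) Stirling number of the first kind: $x(x-1)\cdots(x-n+1)=\sum_{m=0}^n S_1(n,m)x^m$. *)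

(* Defs.v *)
From HB Require Import structures.
From mathcomp Require Import all_boot all_order all_algebra.
From mathcomp Require Import boolp.
From mathcomp Require Import zify.

Set Implicit Arguments.
Unset Strict Implicit.
Unset Printing Implicit Defensive.

Import GRing.Theory.
Local Open Scope ring_scope.

(* R[[t]]; a record rather than an alias of nat -> R, which already carries
   the pointwise ring structure. *)
Record fps (R : Type) := FPS { fpscoef : nat -> R }.

HB.instance Definition _ (R : Type) := gen_eqMixin (fps R).
HB.instance Definition _ (R : Type) := gen_choiceMixin (fps R).

Lemma fpsP (R : Type) (f g : fps R) :
  (forall n, fpscoef f n = fpscoef g n) <-> f = g.
Proof. by split=> [|-> //]; case: f; case: g => g f /= fg; congr FPS; apply: funext. Qed.

Section Zmodule.
Variable R : zmodType.
Implicit Types f g : fps R.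

Definition fps_zero : fps R := FPS (fun=> 0).
Definition fps_opp f : fps R := FPS (fun n => - fpscoef f n).
Definition fps_add f g : fps R := FPS (fun n => fpscoef f n + fpscoef g n).

Lemma fps_addA : associative fps_add.
Proof. by move=> f g h; apply/fpsP=> n /=; rewrite addrA. Qed.
Lemma fps_addC : commutative fps_add.
Proof. by move=> f g; apply/fpsP=> n /=; rewrite addrC. Qed.
Lemma fps_add0 : left_id fps_zero fps_add.
Proof. by move=> f; apply/fpsP=> n /=; rewrite add0r. Qed.
Lemma fps_addN : left_inverse fps_zero fps_opp fps_add.
Proof. by move=> f; apply/fpsP=> n /=; rewrite addNr. Qed.

HB.instance Definition _ :=
  GRing.isZmodule.Build (fps R) fps_addA fps_addC fps_add0 fps_addN.

Lemma coef_fps0 n : fpscoef (0 : fps R) n = 0.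
Proof. by []. Qed.
Lemma coef_fpsN f n : fpscoef (- f) n = - fpscoef f n.
Proof. by []. Qed.
Lemma coef_fpsD f g n : fpscoef (f + g) n = fpscoef f n + fpscoef g n.
Proof. by []. Qed.
Lemma coef_fpsB f g n : fpscoef (f - g) n = fpscoef f n - fpscoef g n.
Proof. by []. Qed.
Lemma coef_fps_sum (I : Type) (s : seq I) (P : pred I) (F : I -> fps R) n :
  fpscoef (\sum_(i <- s | P i) F i) n = \sum_(i <- s | P i) fpscoef (F i) n.
Proof. by apply: (big_morph (fun f => fpscoef f n)). Qed.

End Zmodule.

Section Ring.
Variable R : comNzRingType.
Implicit Types f g h : fps R.

Definition fps_one : fps R := FPS (fun n => (n == 0%N)%:R).
Definition fps_mul f g : fps R :=
  FPS (fun n => \sum_(i < n.+1) fpscoef f i * fpscoef g (n - i)).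

Let trunc N f : {poly R} := \poly_(i < N) fpscoef f i.

Let coef_mul_trunc N f g n : (n < N)%N ->
  fpscoef (fps_mul f g) n = (trunc N f * trunc N g)`_n.
Proof.
move=> nN; rewrite coefM; apply: eq_bigr => -[i /=]; rewrite ltnS => le_in _.
by rewrite !coef_poly (leq_ltn_trans le_in nN) (leq_ltn_trans (leq_subr _ _) nN).
Qed.

Lemma fps_mulC : commutative fps_mul.
Proof. by move=> f g; apply/fpsP=> n; rewrite !(@coef_mul_trunc n.+1) // mulrC. Qed.

Lemma fps_mulA : associative fps_mul.
Proof.
move=> f g h; apply/fpsP=> n.
transitivity ((trunc n.+1 f * (trunc n.+1 g * trunc n.+1 h))`_n).
  rewrite coefM; apply: eq_bigr => i _; rewrite coef_poly ltn_ord; congr (_ * _).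
  by rewrite (@coef_mul_trunc n.+1) // ltnS leq_subr.
rewrite mulrA coefM; apply: eq_bigr => i _.
rewrite [(trunc _ h)`_ _]coef_poly ltnS leq_subr; congr (_ * _).
by rewrite (@coef_mul_trunc n.+1).
Qed.

Lemma fps_mul1 : left_id fps_one fps_mul.
Proof.
move=> f; apply/fpsP=> n /=; rewrite big_ord_recl /= mul1r subn0 big1 ?addr0 //.
by move=> i _; rewrite mul0r.
Qed.

Lemma fps_mulDl : left_distributive fps_mul +%R.
Proof.
move=> f g h; apply/fpsP=> n /=; rewrite -big_split /=.
by apply: eq_bigr => i _; rewrite mulrDl.
Qed.

Lemma fps_one_neq0 : fps_one != 0.
Proof.
by apply/eqP => /fpsP /(_ 0%N) /= /eqP; rewrite (negPf (oner_neq0 R)).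
Qed.

HB.instance Definition _ := GRing.Zmodule_isComNzRing.Build (fps R)
  fps_mulA fps_mulC fps_mul1 fps_mulDl fps_one_neq0.

Lemma coef_fps1 n : fpscoef (1 : fps R) n = (n == 0%N)%:R.
Proof. by []. Qed.
Lemma coef_fpsM f g n :
  fpscoef (f * g) n = \sum_(i < n.+1) fpscoef f i * fpscoef g (n - i).
Proof. by []. Qed.

Lemma coef_fpsX_lt f j n : fpscoef f 0 = 0 -> (n < j)%N -> fpscoef (f ^+ j) n = 0.
Proof.
move=> f0; elim: j n => // j IHj n; rewrite ltnS => le_nj.
rewrite exprS coef_fpsM big_ord_recl f0 mul0r add0r big1 // => -[i /= lt_in] _.
by rewrite IHj ?mulr0 // /bump /=; lia.
Qed.

(* The composition f(g(t)); meaningful only when g has constant term 0, in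
   which case the omitted terms j > n do not contribute to t^n. *)
Definition fps_comp f g : fps R :=
  FPS (fun n => \sum_(j < n.+1) fpscoef f j * fpscoef (g ^+ j) n).

(* f / t, for f with constant term 0. *)
Definition fps_divt f : fps R := FPS (fun n => fpscoef f n.+1).

End Ring.

Section UnitRing.
Variable R : comUnitRingType.
Implicit Types f g : fps R.

Definition fps_unit : pred (fps R) := fun f => fpscoef f 0 \is a GRing.unit.

(* 1/f = c * \sum_j (1 - c f)^j with c the inverse of the constant term; the
   terms j > n do not contribute to t^n.  As in every unitRingType, the
   inverse of a non-unit is itself. *)
Definition fps_subr1 f : fps R :=
  FPS (fun n => (n == 0%N)%:R - (fpscoef f 0)^-1 * fpscoef f n).
Definition fps_inv f : fps R :=
  if fps_unit f
  then FPS (fun n =>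
         (fpscoef f 0)^-1 * \sum_(j < n.+1) fpscoef (fps_subr1 f ^+ j) n)
  else f.

Lemma fps_mulV : {in fps_unit, left_inverse 1 fps_inv *%R}.
Proof.
move=> f uf; rewrite /fps_inv; have -> : fps_unit f by [].
set c := (fpscoef f 0)^-1; pose g := fps_subr1 f.
have g0 : fpscoef g 0 = 0 by rewrite /= mulVr ?subrr.
apply/fpsP=> n; rewrite mulrC.
pose s := \sum_(j < n.+1) g ^+ j.
have hs i : (i <= n)%N -> \sum_(j < i.+1) fpscoef (g ^+ j) i = fpscoef s i.
  move=> le_in; rewrite coef_fps_sum.
  rewrite (big_ord_widen n.+1 (fun j => fpscoef (g ^+ j) i)) // big_mkcond /=.
  by apply: eq_bigr => j _; case: ltnP => // ?; rewrite coef_fpsX_lt.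
transitivity (fpscoef ((1 - g) * s) n).
  rewrite !coef_fpsM; apply: eq_bigr => i _ /=; rewrite -hs ?leq_subr //.
  by rewrite mulrA; congr (_ * _); rewrite ?coef_fpsB /= opprB addrC subrK mulrC.
have -> : (1 - g) * s = 1 - g ^+ n.+1 by rewrite -opprB mulNr -subrX1 opprB.
by rewrite coef_fpsB coef_fpsX_lt ?subr0.
Qed.

Lemma fps_unitP f g : g * f = 1 -> fps_unit f.
Proof.
move=> gf1; apply/unitrPr; exists (fpscoef g 0).
by move/fpsP/(_ 0%N): gf1; rewrite coef_fpsM big_ord1 subn0 mulrC.
Qed.

Lemma fps_inv_out : {in [predC fps_unit], fps_inv =1 id}.
Proof. by move=> f nuf; rewrite /fps_inv; have /negPf -> : ~~ fps_unit f by []. Qed.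

HB.instance Definition _ := GRing.ComNzRing_hasMulInverse.Build (fps R)
  fps_mulV fps_unitP fps_inv_out.

Lemma unit_fpsE f : (f \is a GRing.unit) = (fpscoef f 0 \is a GRing.unit).
Proof. by []. Qed.

Definition fps_exp (a : R) : fps R := FPS (fun n => a ^+ n / n`!%:R).

Definition fps_log1 : fps R :=
  FPS (fun n => if n is m.+1 then (-1) ^+ m / m.+1%:R else 0).

(* (1 + t)^a as Newton's binomial series. *)
Definition fps_pow1 (a : R) : fps R :=
  FPS (fun n => (\prod_(i < n) (a - i%:R)) / n`!%:R).

Definition fps_Lif (k : int) : fps R :=
  FPS (fun n => (n`!%:R * n.+1%:R ^ k)^-1).

(* t / log(1+t) and t / (e^t - 1) *)
Definition fps_tlog : fps R := (fps_divt fps_log1)^-1.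
Definition fps_texp : fps R := (fps_divt (fps_exp 1 - 1))^-1.

Lemma fps_tlog_unit : fps_tlog \is a GRing.unit.
Proof. by rewrite unitrV unit_fpsE /= expr0 divr1 unitr1. Qed.

Lemma fps_texp_unit : fps_texp \is a GRing.unit.
Proof. by rewrite unitrV unit_fpsE /= subr0 expr1 divr1 unitr1. Qed.

End UnitRing.

Arguments fps_log1 {R}.
Arguments fps_Lif {R} k.
Arguments fps_tlog {R}.
Arguments fps_texp {R}.

(* The generating functions below live in F[x][[t]], with 'X standing for x. *)

Definition polyA (F : fieldType) (r k : int) (n : nat) : {poly F} :=
  n`!%:R * fpscoef (fps_tlog ^ r * fps_comp (fps_Lif k) fps_log1 / fps_pow1 'X) n.

Definition polyB (F : fieldType) (alpha : int) (n : nat) : {poly F} :=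
  n`!%:R * fpscoef (fps_texp ^ alpha * fps_exp 'X) n.

Definition stirling1 (n m : nat) : int :=
  (\prod_(i < n) ('X - i%:R%:P) : {poly int})`_m.

(* Main.v *)
(* Write E(u) = (e^u - 1)/u.  Substituting u = log(1+t), so that t = e^u - 1,
   the generating function of the A_n(x) becomes Phi_x(log(1+t)) with
   Phi_x(u) = E(u)^r Lif_k(u) e^(-xu).  Since d/dt log(1+t) = e^(-u), its
   t-derivative is (Phi_x' e^(-u))(log(1+t)), and the product rule, together
   with E' e^(-u) = (u - 1 + e^(-u))/u^2 = \sum_a (-u)^a/(a+2)!, splits
   Phi_x' e^(-u) into
     - x Phi_(x+1) + r E^(r-1) (E' e^(-u)) Lif_k e^(-xu)
       + E^r Lif_k' e^(-(x+1)u).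
   The n-th exponential coefficient of f(log(1+t)) is \sum_m S_1(n,m) m! [u^m] f,
   which gives the three groups of terms. *)

Require Import Defs.
From HB Require Import structures.
From mathcomp Require Import all_boot all_order all_algebra.
From mathcomp Require Import reals complex.
From mathcomp Require Import ring zify.

Set Implicit Arguments.
Unset Strict Implicit.
Unset Printing Implicit Defensive.

Import GRing.Theory.
Local Open Scope ring_scope.

(** * Formal power series: derivation, composition and exponential coefficients *)

Section FormalSeries.
Variable R : comNzRingType.
Implicit Types f g h : fps R.

Definition fps_t : fps R := FPS (fun n => (n == 1)%:R).

Definition fps_const (c : R) : fps R := FPS (fun n => c *+ (n == 0)).

Lemma coef_fpsMn f m n : fpscoef (f *+ m) n = fpscoef f n *+ m.
Proof. by elim: m => // m IHm; rewrite !mulrS coef_fpsD IHm. Qed.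

Lemma fps_const_is_zmod_morphism : zmod_morphism fps_const.
Proof. by move=> a b; apply/fpsP => n /=; rewrite mulrnBl. Qed.

Lemma coef_fps_constM c f n : fpscoef (fps_const c * f) n = c * fpscoef f n.
Proof.
rewrite coef_fpsM big_ord_recl subn0 big1 ?addr0 // => i _.
by rewrite /= mulr0n mul0r.
Qed.

Lemma fps_const_is_monoid_morphism : monoid_morphism fps_const.
Proof.
split=> [|a b]; apply/fpsP => n; last by rewrite coef_fps_constM /= mulrnAr.
by rewrite coef_fps1.
Qed.

HB.instance Definition _ :=
  GRing.isZmodMorphism.Build R (fps R) fps_const fps_const_is_zmod_morphism.
HB.instance Definition _ :=
  GRing.isMonoidMorphism.Build R (fps R) fps_const fps_const_is_monoid_morphism.

Lemma coef_fpstM f n :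
  fpscoef (fps_t * f) n = if n is m.+1 then fpscoef f m else 0.
Proof.
rewrite coef_fpsM big_ord_recl mul0r add0r.
case: n => [|n]; first by rewrite big_ord0.
rewrite big_ord_recl big1 ?addr0 /= ?mul1r ?subn1 // => i _.
by rewrite mul0r.
Qed.

(** Takes the place of division by t, which is not a unit in R[[t]]. *)
Lemma fps_t_inj : injective (fun f => fps_t * f).
Proof.
move=> f g /fpsP fg; apply/fpsP => n.
by have := fg n.+1; rewrite !coef_fpstM.
Qed.

Lemma fps_divtK f : fpscoef f 0 = 0 -> fps_t * fps_divt f = f.
Proof. by move=> f0; apply/fpsP => -[|n]; rewrite coef_fpstM. Qed.

Definition fps_deriv f : fps R := FPS (fun n => n.+1%:R * fpscoef f n.+1).

Lemma fps_derivB f g : fps_deriv (f - g) = fps_deriv f - fps_deriv g.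
Proof. by apply/fpsP => n /=; rewrite mulrBr. Qed.

Lemma fps_deriv1 : fps_deriv 1 = 0.
Proof. by apply/fpsP => n /=; rewrite mulr0. Qed.

Lemma fps_deriv_t : fps_deriv fps_t = 1.
Proof. by apply/fpsP => -[|n] /=; rewrite ?mulr0 ?mulr1. Qed.

Lemma fps_derivM f g : fps_deriv (f * g) = fps_deriv f * g + f * fps_deriv g.
Proof.
apply/fpsP => n; rewrite coef_fpsD /=.
(* The weight n+1 splits as i + (n+1-i); the first part yields f' g, the second f g'. *)
rewrite mulr_sumr (eq_bigr (fun i : 'I_n.+2 =>
  i%:R * (fpscoef f i * fpscoef g (n.+1 - i)) +
  (n.+1 - i)%:R * (fpscoef f i * fpscoef g (n.+1 - i)))); last first.
  by move=> i _; rewrite -mulrDl -natrD subnKC // -ltnS.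
rewrite big_split /=; congr (_ + _).
  rewrite big_ord_recl mul0r add0r; apply: eq_bigr => i _.
  by rewrite mulrA.
rewrite big_ord_recr /= subnn mul0r addr0; apply: eq_bigr => i _.
have le_in : (i <= n)%N by rewrite -ltnS.
by rewrite subSn // mulrCA.
Qed.

Lemma fps_derivX f m : fps_deriv (f ^+ m) = f ^+ m.-1 * fps_deriv f *+ m.
Proof.
elim: m => [|m IHm]; first by rewrite fps_deriv1.
rewrite exprS fps_derivM IHm mulrS mulrC; congr (_ + _) => /=.
by case: m {IHm} => [|m]; rewrite ?mulr0n ?mulr0 // mulrnAr mulrA -exprS.
Qed.

(** The series h^j has no term of degree below j, so the added summands vanish and different
    coefficients can share one range of summation. *)
Lemma fps_compE N f h n : fpscoef h 0 = 0 -> (n < N)%N ->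
  fpscoef (fps_comp f h) n = \sum_(j < N) fpscoef f j * fpscoef (h ^+ j) n.
Proof.
move=> h0 nN /=.
rewrite (big_ord_widen N (fun j => fpscoef f j * fpscoef (h ^+ j) n)) //.
rewrite big_mkcond; apply: eq_bigr => j _.
by case: ltnP => // nj; rewrite coef_fpsX_lt ?mulr0.
Qed.

Lemma coef_horner_fps (p : {poly R}) h n : fpscoef h 0 = 0 ->
  fpscoef (map_poly fps_const p).[h] n =
  \sum_(j < n.+1) p`_j * fpscoef (h ^+ j) n.
Proof.
move=> h0; rewrite (@horner_coef_wide _ (maxn n.+1 (size p))); last first.
  by rewrite (leq_trans (size_poly _ _)) // leq_maxr.
rewrite coef_fps_sum.
rewrite -[RHS](@fps_compE _ (FPS (nth 0 p))) //.
rewrite (@fps_compE (maxn n.+1 (size p))) ?leq_maxl //.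
by apply: eq_bigr => j _; rewrite coef_map coef_fps_constM.
Qed.

Lemma fps_comp1 h : fps_comp 1 h = 1.
Proof.
apply/fpsP => n /=; rewrite big_ord_recl mul1r big1 ?addr0 // => i _.
by rewrite mul0r.
Qed.

Lemma fps_compD f g h : fps_comp (f + g) h = fps_comp f h + fps_comp g h.
Proof.
apply/fpsP => n; rewrite coef_fpsD /= -big_split /=.
by apply: eq_bigr => i _; rewrite mulrDl.
Qed.

Lemma fps_compB f g h : fps_comp (f - g) h = fps_comp f h - fps_comp g h.
Proof. by apply: (canRL (addrK _)); rewrite -fps_compD subrK. Qed.

(* Modulo t^N, composition is evaluation of a polynomial at h, which is
   multiplicative. *)
Lemma fps_compM f g h : fpscoef h 0 = 0 ->
  fps_comp (f * g) h = fps_comp f h * fps_comp g h.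
Proof.
move=> h0; apply/fpsP => n.
pose P (u : fps R) := \poly_(i < n.+1) fpscoef u i.
have compP u i : (i <= n)%N ->
    fpscoef (fps_comp u h) i = fpscoef (map_poly fps_const (P u)).[h] i.
  move=> le_in; rewrite coef_horner_fps //; apply: eq_bigr => j _.
  by rewrite coef_poly (leq_trans (ltn_ord j)).
transitivity (fpscoef (map_poly fps_const (P f * P g)).[h] n).
  rewrite coef_horner_fps //; apply: eq_bigr => j _; congr (_ * _).
  rewrite coefM; apply: eq_bigr => i _; rewrite !coef_poly.
  by rewrite (leq_trans (ltn_ord i)) ?ifT //; have := ltn_ord j; lia.
rewrite rmorphM hornerM !coef_fpsM; apply: eq_bigr => i _.
by rewrite -!compP ?leq_subr // -ltnS.
Qed.

Lemma fps_comp_t h : fpscoef h 0 = 0 -> fps_comp fps_t h = h.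
Proof.
move=> h0; apply/fpsP => n; rewrite (@fps_compE n.+2) //.
rewrite 2!big_ord_recl big1 ?addr0 => [|i _]; last by rewrite mul0r.
by rewrite mul0r add0r mul1r expr1.
Qed.

Lemma fps_deriv_comp f h : fpscoef h 0 = 0 ->
  fps_deriv (fps_comp f h) = fps_comp (fps_deriv f) h * fps_deriv h.
Proof.
move=> h0; apply/fpsP => n.
transitivity (\sum_(j < n.+2) fpscoef f j * fpscoef (fps_deriv (h ^+ j)) n).
  by rewrite /= mulr_sumr; apply: eq_bigr => j _; rewrite mulrCA.
rewrite big_ord_recl expr0 fps_deriv1 mulr0 add0r.
(* Indices over a full square allow the two sums to be exchanged; [fps_compE] then recognises the
   sum over j as a coefficient of f'(h). *)
transitivity (\sum_(j < n.+1) \sum_(i < n.+1) fpscoef (fps_deriv f) j *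
   fpscoef (h ^+ j) i * fpscoef (fps_deriv h) (n - i)).
  apply: eq_bigr => j _; rewrite fps_derivX coef_fpsMn coef_fpsM.
  rewrite -mulr_natl mulrA [fpscoef f _ * _]mulrC mulr_sumr.
  by apply: eq_bigr => i _; rewrite mulrA.
rewrite exchange_big coef_fpsM; apply: eq_bigr => i _.
by rewrite (@fps_compE n.+1) // mulr_suml.
Qed.

(** The coefficient of t^n/n!. In this normalisation derivation is a shift and a product is a
    binomial convolution. *)
Definition egf f n : R := n`!%:R * fpscoef f n.

Lemma egfD f g n : egf (f + g) n = egf f n + egf g n.
Proof. exact: mulrDr. Qed.

Lemma egf_deriv f n : egf (fps_deriv f) n = egf f n.+1.
Proof. by rewrite /egf /= mulrA -natrM mulnC factS. Qed.

Lemma egf_constM c f n : egf (fps_const c * f) n = c * egf f n.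
Proof. by rewrite /egf coef_fps_constM mulrCA. Qed.

Lemma egfM f g n : egf (f * g) n =
  \sum_(0 <= i < n.+1) 'C(n, i)%:R * egf f i * egf g (n - i).
Proof.
rewrite /egf coef_fpsM mulr_sumr big_mkord; apply: eq_bigr => i _.
have le_in : (i <= n)%N by rewrite -ltnS.
rewrite -(@bin_fact n i) // !natrM; ring.
Qed.

End FormalSeries.

Arguments fps_t {R}.

(** * Recurrence of the Stirling numbers of the first kind *)

Lemma stirling1_0 n : stirling1 n 0 = (n == 0)%:R.
Proof.
rewrite /stirling1 -horner_coef0 horner_prod; case: n => [|n].
  by rewrite big_ord0.
by rewrite big_ord_recl hornerXsubC subrr mul0r.
Qed.

Lemma stirling1_0S m : stirling1 0 m.+1 = 0.
Proof. by rewrite /stirling1 big_ord0 coef1. Qed.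

Lemma stirling1S n m :
  stirling1 n.+1 m.+1 = stirling1 n m - n%:R * stirling1 n m.+1.
Proof.
by rewrite /stirling1 big_ord_recr /= mulrBr coefB coefMX coefMC mulrC.
Qed.

(** * Ring morphisms acting on coefficients *)

Section Map.
Variables (R S : comNzRingType) (phi : {rmorphism R -> S}).

(** Serves for two morphisms: the embedding [polyC] of constants and the substitution of a
    polynomial for x. *)
Definition fps_map (f : fps R) : fps S := FPS (fun n => phi (fpscoef f n)).

Lemma fps_map_is_zmod_morphism : zmod_morphism fps_map.
Proof. by move=> f g; apply/fpsP => n /=; rewrite rmorphB. Qed.

Lemma fps_map_is_monoid_morphism : monoid_morphism fps_map.
Proof.
split=> [|f g]; apply/fpsP => n /=; first by rewrite rmorph_nat.
by rewrite rmorph_sum; apply: eq_bigr => i _; rewrite rmorphM.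
Qed.

HB.instance Definition _ :=
  GRing.isZmodMorphism.Build (fps R) (fps S) fps_map fps_map_is_zmod_morphism.
HB.instance Definition _ :=
  GRing.isMonoidMorphism.Build (fps R) (fps S) fps_map
    fps_map_is_monoid_morphism.

End Map.

(** * Exponential and logarithm series, and the substitution u = log(1+t) *)

Section ExpLog.
Variable R : comUnitRingType.
(** Expresses characteristic zero in a form that also suits [{poly F}], which is not a field. *)
Hypothesis natU : forall n, n.+1%:R \is a @GRing.unit R.
Implicit Types (a b : R) (f g h : fps R).

Let factU n : n`!%:R \is a @GRing.unit R.
Proof. by rewrite -(prednK (fact_gt0 n)). Qed.

Lemma egf_inj f g : egf f =1 egf g -> f = g.
Proof. by move=> fg; apply/fpsP => n; apply: (mulrI (factU n)); apply: fg. Qed.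

(** The series E; its inverse is [fps_texp]. *)
Definition fps_e1t : fps R := fps_divt (fps_exp 1 - 1).

Lemma egf_exp a n : egf (fps_exp a) n = a ^+ n.
Proof. by rewrite /egf /= mulrC divrK. Qed.

(** In exponential coefficients this is the binomial theorem. *)
Lemma fps_expD a b : fps_exp (a + b) = fps_exp a * fps_exp b.
Proof.
apply: egf_inj => n; rewrite egf_exp egfM addrC exprDn big_mkord.
apply: eq_bigr => i _; rewrite !egf_exp -mulr_natl; ring.
Qed.

Lemma fps_exp0 : fps_exp 0 = 1 :> fps R.
Proof.
apply: egf_inj => n; rewrite egf_exp /egf coef_fps1 expr0n.
by case: n => [|n]; rewrite ?mulr0 ?mulr1.
Qed.

Lemma fps_deriv_exp a : fps_deriv (fps_exp a) = fps_const a * fps_exp a.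
Proof.
by apply: egf_inj => n; rewrite egf_deriv egf_constM !egf_exp exprS.
Qed.

Lemma fps_t_e1t : fps_t * fps_e1t = fps_exp 1 - 1.
Proof. by rewrite fps_divtK //= divr1 subrr. Qed.

Lemma fps_e1t_unit : fps_e1t \is a GRing.unit.
Proof. by rewrite unit_fpsE /= subr0 expr1 divr1 unitr1. Qed.

Lemma fps_expNK : fps_exp 1 * fps_exp (-1) = 1 :> fps R.
Proof. by rewrite -fps_expD subrr fps_exp0. Qed.

(* With E = (e^t - 1)/t: both sides are (t - 1 + e^(-t))/t^2. *)
Lemma fps_deriv_e1t :
  fps_deriv fps_e1t * fps_exp (-1) = fps_divt (fps_divt (fps_exp (-1))).
Proof.
set D := fps_deriv _; set H := fps_divt (fps_divt _).
(* The product rule applied to t E = e^t - 1. *)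
have DE : fps_e1t + fps_t * D = fps_exp 1.
  have /(congr1 (@fps_deriv R)) := fps_t_e1t.
  rewrite fps_derivM fps_deriv_t mul1r => ->.
  by rewrite fps_derivB fps_deriv1 subr0 fps_deriv_exp rmorph1 mul1r.
(* By construction t^2 [H] is e^(-t) without its first two terms 1 - t. *)
have e2 : fps_exp (-1) = 1 + fps_t * (- 1 + fps_t * H) :> fps R.
  apply/fpsP => -[|[|n]].
  - by rewrite coef_fpsD coef_fpstM /= addr0 divr1.
  - by rewrite coef_fpsD coef_fpstM coef_fpsD coef_fpsN coef_fpstM /= add0r
      addr0 divr1.
  - by rewrite coef_fpsD coef_fpstM coef_fpsD coef_fpsN coef_fpstM /= oppr0
      !add0r.
have Ee : fps_e1t * fps_exp (-1) = 1 - fps_t * H.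
  apply: fps_t_inj => /=; rewrite mulrA fps_t_e1t mulrBl fps_expNK mul1r e2.
  ring.
apply: fps_t_inj => /=; rewrite mulrA.
have -> : fps_t * D = fps_exp 1 - fps_e1t by rewrite -DE; ring.
by rewrite mulrBl fps_expNK Ee; ring.
Qed.

Let t0 : fpscoef (@fps_log1 R) 0 = 0. Proof. by []. Qed.

(** The derivative is the geometric series of the (-t)^n, whose product with 1 + t telescopes. *)
Lemma fps_deriv_log1 : (1 + fps_t) * fps_deriv (@fps_log1 R) = 1.
Proof.
rewrite mulrDl mul1r; apply/fpsP => -[|n].
  by rewrite coef_fpsD coef_fpstM /= addr0 expr0 mul1r divr1.
rewrite coef_fpsD coef_fpstM /=.
by rewrite ![_.+1%:R * _]mulrC !divrK // exprS mulN1r addNr.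
Qed.

Lemma fps_comp_const c h : fps_comp (fps_const c) h = fps_const c.
Proof.
apply/fpsP => n /=; rewrite big_ord_recl big1 ?addr0 => [|i _]; last first.
  by rewrite mul0r.
by rewrite expr0 coef_fps1 mulr_natr.
Qed.

(** Turns differential equations in (1+t) d/dt into recurrences; used for the binomial series and
    for the powers of log(1+t). *)
Lemma egf_1t_deriv f n :
  egf ((1 + fps_t) * fps_deriv f) n = egf f n.+1 + n%:R * egf f n.
Proof.
rewrite mulrDl mul1r egfD egf_deriv; congr (_ + _).
rewrite /egf coef_fpstM; case: n => [|n]; first by rewrite mulr0 mul0r.
by rewrite /= mulrCA.
Qed.

Lemma egf_pow1 a n : egf (fps_pow1 a) n = \prod_(i < n) (a - i%:R).
Proof. by rewrite /egf /= mulrC divrK. Qed.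

(* Both sides solve (1 + t) y' = a y, y(0) = 1. *)
Lemma fps_comp_exp_log1 a : fps_comp (fps_exp a) fps_log1 = fps_pow1 a.
Proof.
set f := fps_comp _ _.
have df : (1 + fps_t) * fps_deriv f = fps_const a * f.
  rewrite /f fps_deriv_comp // mulrCA fps_deriv_log1 mulr1 fps_deriv_exp.
  by rewrite fps_compM // fps_comp_const.
apply: egf_inj; elim=> [|n IHn].
  by rewrite egf_pow1 /egf /= big_ord1 /= big_ord0 expr0 divr1 !mul1r.
rewrite egf_pow1 big_ord_recr /= -egf_pow1 -IHn.
have := congr1 (fun u => egf u n) df.
rewrite egf_1t_deriv egf_constM => /(canRL (addrK _)) ->; ring.
Qed.

Lemma fps_pow1_1 : fps_pow1 1 = 1 + fps_t :> fps R.
Proof.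
apply/fpsP => -[|[|n]]; rewrite coef_fpsD /=.
- by rewrite big_ord0 divr1 addr0.
- by rewrite big_ord1 subr0 divr1 add0r.
(* From degree 2 on the product contains the factor 1 - 1. *)
- by rewrite 2!big_ord_recl /= subrr mul0r mulr0 mul0r addr0.
Qed.

Lemma fps_deriv_log1E :
  fps_deriv fps_log1 = fps_comp (fps_exp (-1)) fps_log1 :> fps R.
Proof.
(* The factor 1 is rewritten as e^u e^(-u) at u = log(1+t), where e^u = 1 + t cancels against the
   derivative. *)
rewrite -[LHS]mulr1 -(fps_comp1 fps_log1) -fps_expNK fps_compM //.
by rewrite fps_comp_exp_log1 fps_pow1_1 mulrA [fps_deriv _ * _]mulrC
  fps_deriv_log1 mul1r.
Qed.

(** With L = log(1+t)/t, one has t L E(log(1+t)) = e^(log(1+t)) - 1 = t, so L and E(log(1+t)) are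
    mutually inverse. *)
Lemma fps_tlogE : fps_tlog = fps_comp fps_e1t fps_log1.
Proof.
have LE : fps_divt fps_log1 * fps_comp fps_e1t fps_log1 = 1.
  apply: fps_t_inj; rewrite mulrA fps_divtK // mulr1.
  rewrite -{1}(fps_comp_t t0) -fps_compM // fps_t_e1t fps_compB.
  by rewrite fps_comp_exp_log1 fps_comp1 fps_pow1_1 addrC addKr.
have uL : fps_divt (@fps_log1 R) \is a GRing.unit.
  by rewrite unit_fpsE /= expr0 divr1 unitr1.
by apply: (mulrI uL); rewrite mulrV.
Qed.

Lemma fps_compV f h : fpscoef h 0 = 0 -> f \is a GRing.unit ->
  fps_comp f^-1 h = (fps_comp f h)^-1.
Proof.
move=> h0 uf.
have VK : fps_comp f h * fps_comp f^-1 h = 1.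
  by rewrite -fps_compM // mulrV // fps_comp1.
have ufh : fps_comp f h \is a GRing.unit.
  by apply/unitrPr; exists (fps_comp f^-1 h).
by apply: (mulrI ufh); rewrite VK mulrV.
Qed.

Lemma fps_compX f h m : fpscoef h 0 = 0 ->
  fps_comp (f ^+ m) h = fps_comp f h ^+ m.
Proof.
move=> h0; elim: m => [|m IHm]; first by rewrite fps_comp1.
by rewrite !exprS fps_compM // IHm.
Qed.

Lemma fps_compXz f h (r : int) : fpscoef h 0 = 0 -> f \is a GRing.unit ->
  fps_comp (f ^ r) h = fps_comp f h ^ r.
Proof.
move=> h0 uf; case: r => m; first exact: fps_compX.
by rewrite /exprz fps_compV ?unitrX // fps_compX.
Qed.

Lemma fps_derivXz f (r : int) : f \is a GRing.unit ->
  fps_deriv (f ^ r) = r%:~R * f ^ (r - 1) * fps_deriv f.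
Proof.
move=> uf; case: r => m.
  rewrite [_ ^ _]/(f ^+ m) fps_derivX; case: m => [|m].
    by rewrite mulr0n !mul0r.
  have -> : Posz m.+1 - 1 = m by lia.
  by rewrite -mulr_natl mulrA.
(* For the exponent -(m+1), differentiating f^-(m+1) f^(m+1) = 1 determines the derivative up to the
   unit f^(m+1). *)
have /(congr1 (@fps_deriv R)) := mulVr (unitrX m.+1 uf).
rewrite fps_derivM fps_deriv1 fps_derivX => /eqP.
rewrite addr_eq0 => /eqP dv.
apply: (mulIr (unitrX m.+1 uf)); rewrite [LHS]dv.
have -> : f ^ (Negz m - 1) = f ^- m.+2 by rewrite NegzE -opprD addrC.
have fK : f ^- m.+2 * f ^+ m.+1 = f ^- m.+1 * f ^+ m.
  by rewrite -!exprVn (exprSr _ m.+1) (exprS f) -mulrA mulKr.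
rewrite [RHS]mulrAC -[_ * _ * f ^+ m.+1]mulrA fK NegzE mulrNz -mulr_natl /=.
ring.
Qed.

(** Since (1+t) d/dt sends log(1+t)^(m+1) to (m+1) log(1+t)^m, the coefficients obey the recurrence
    [stirling1S], scaled by m!. *)
Lemma egf_log1X m n :
  egf (fps_log1 ^+ m) n = m`!%:R * (stirling1 n m)%:~R :> R.
Proof.
elim: n m => [|n IHn] [|m].
- by rewrite /egf stirling1_0 coef_fps1.
- by rewrite /egf stirling1_0S exprS coef_fpsM big_ord1 mul0r !mulr0.
- by rewrite /egf stirling1_0 coef_fps1 !mulr0.
have : egf ((1 + fps_t) * fps_deriv (@fps_log1 R ^+ m.+1)) n =
       m.+1%:R * egf (@fps_log1 R ^+ m) n.
  rewrite fps_derivX mulrnAr mulrCA fps_deriv_log1 mulr1.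
  by rewrite /egf coef_fpsMn mulrnAr [RHS]mulr_natl.
rewrite egf_1t_deriv => /(canRL (addrK _)) ->.
rewrite !IHn stirling1S factS natrM rmorphB rmorphM /= rmorph_nat; ring.
Qed.

Lemma egf_comp_log1 f n : egf (fps_comp f fps_log1) n =
  \sum_(0 <= m < n.+1) (stirling1 n m)%:~R * egf f m.
Proof.
rewrite big_mkord /egf /= mulr_sumr; apply: eq_bigr => m _.
rewrite mulrCA [_ * fpscoef (_ ^+ _) _](egf_log1X m n); ring.
Qed.

Lemma egf_Lif (k : int) n : egf (fps_Lif k) n = (n.+1%:R ^ k)^-1 :> R.
Proof. by rewrite /egf /= invrM ?unitrXz // mulrCA mulrV // mulr1. Qed.

(** Source of the factor (-1)^a / ((a+2)(a+1)): it is n! times the coefficient (-1)^(n+2)/(n+2)! of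
    e^(-t). *)
Lemma egf_divt2_expN1 n :
  egf (fps_divt (fps_divt (fps_exp (-1)))) n =
  (-1) ^+ n / (n.+2%:R * n.+1%:R) :> R.
Proof.
apply: (mulIr (natU n.+1)); apply: (mulIr (natU n)).
rewrite -[RHS]mulrA divrK ?unitrM ?natU //.
rewrite -mulrA -natrM /egf /= mulrAC.
have -> : n`!%:R * (n.+2 * n.+1)%:R = (n.+2)`!%:R :> R.
  by rewrite -natrM !factS mulnC mulnA.
by rewrite mulrC divrK // !exprS !mulN1r opprK.
Qed.

(** This is Phi_a(u), with any ring element a in place of x so that x + 1 or another polynomial can
    be inserted. *)
Definition polyA_egf (r k : int) a := fps_e1t ^ r * (fps_Lif k * fps_exp (- a)).

Lemma polyA_egfE (r k : int) a :
  fps_tlog ^ r * fps_comp (fps_Lif k) fps_log1 / fps_pow1 a =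
  fps_comp (polyA_egf r k a) fps_log1.
Proof.
rewrite /polyA_egf !fps_compM // fps_compXz ?fps_e1t_unit // -fps_tlogE mulrA.
congr (_ * _); rewrite -fps_comp_exp_log1.
have expK : fps_exp a * fps_exp (- a) = 1 by rewrite -fps_expD subrr fps_exp0.
have ue : fps_exp a \is a GRing.unit by apply/unitrPr; exists (fps_exp (- a)).
rewrite -fps_compV //; congr fps_comp.
by apply: (mulrI ue); rewrite mulrV.
Qed.

(** By the product rule. The factor e^(-u) merges with e^(-au) in the first and third terms and is
    combined with E' in the middle one. *)
Lemma deriv_polyA_egf (r k : int) a :
  fps_deriv (polyA_egf r k a) * fps_exp (-1) =
    fps_const (- a) * polyA_egf r k (a + 1)
    + r%:~R * (fps_Lif k * (fps_divt (fps_divt (fps_exp (-1))) *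
               (fps_e1t ^ (r - 1) * fps_exp (- a))))
    + fps_deriv (fps_Lif k) * (fps_e1t ^ r * fps_exp (- a - 1)).
Proof.
rewrite /polyA_egf !fps_derivM fps_derivXz ?fps_e1t_unit // fps_deriv_exp.
rewrite -fps_deriv_e1t opprD fps_expD; ring.
Qed.

(** This change of sign makes E^(r-1) and E^r produce Bernoulli polynomials of orders 1 - r and
    -r. *)
Lemma texp_expz (r : int) : fps_texp ^ r = fps_e1t ^ (- r).
Proof. by rewrite exprz_inv. Qed.

End ExpLog.

(** * Compatibility of the special series with ring morphisms *)

Section MapUnit.
Variables (R S : comUnitRingType) (phi : {rmorphism R -> S}).
Hypothesis natU : forall n, n.+1%:R \is a @GRing.unit R.

Lemma egf_map (f : fps R) n : egf (fps_map phi f) n = phi (egf f n).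
Proof. by rewrite /egf rmorphM rmorph_nat. Qed.

Lemma fps_map_exp a : fps_map phi (fps_exp a) = fps_exp (phi a).
Proof.
apply/fpsP => n /=; rewrite rmorphM rmorphXn rmorphV ?rmorph_nat //.
by rewrite -(prednK (fact_gt0 n)).
Qed.

Lemma fps_map_Lif k : fps_map phi (fps_Lif k) = fps_Lif k.
Proof.
apply/fpsP => n /=; rewrite rmorphV ?rmorphM ?rmorphXz ?rmorph_nat //.
by rewrite unitrM unitrXz ?natU // -(prednK (fact_gt0 n)) natU.
Qed.

Lemma fps_map_divt (f : fps R) :
  fps_map phi (fps_divt f) = fps_divt (fps_map phi f).
Proof. by []. Qed.

Lemma fps_map_e1t : fps_map phi (fps_e1t R) = fps_e1t S.
Proof.
by rewrite /fps_e1t fps_map_divt rmorphB /= rmorph1 fps_map_exp rmorph1.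
Qed.

Lemma fps_map_e1tX (r : int) : fps_map phi (fps_e1t R ^ r) = fps_e1t S ^ r.
Proof.
by rewrite rmorphXz /= ?fps_map_e1t //; apply: fps_e1t_unit.
Qed.

Lemma map_polyA_egf r k a :
  fps_map phi (polyA_egf r k a) = polyA_egf r k (phi a).
Proof.
by rewrite !rmorphM /= fps_map_e1tX fps_map_Lif fps_map_exp rmorphN.
Qed.

End MapUnit.

(** * The polynomials A_n and B_n, and the recurrence *)

Section PolyAB.
Variable F : fieldType.
Hypothesis natF : forall n, n.+1%:R != 0 :> F.

Let natU n : n.+1%:R \is a @GRing.unit F.
Proof. by rewrite unitfE. Qed.

Let natPU n : n.+1%:R \is a @GRing.unit {poly F}.
Proof. by rewrite -(rmorph_nat (@polyC F)) rmorph_unit. Qed.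

Lemma polyAE r k n :
  polyA F r k n = egf (fps_comp (polyA_egf r k 'X) fps_log1) n.
Proof. by rewrite -polyA_egfE. Qed.

(** Substitution of q for x is a ring morphism on coefficients; it fixes E and Lif_k and only
    changes the exponent of e^(-xu). *)
Lemma comp_polyA r k n q : polyA F r k n \Po q =
  egf (fps_comp (polyA_egf r k q) fps_log1) n.
Proof.
rewrite polyAE !egf_comp_log1 // rmorph_sum; apply: eq_bigr => m _.
rewrite rmorphM /= rmorph_int -egf_map map_polyA_egf //=.
by rewrite comp_polyX.
Qed.

Lemma comp_polyB r n q :
  polyB F r n \Po q = egf (fps_e1t {poly F} ^ (- r) * fps_exp q) n.
Proof.
rewrite [polyB _ _ _](_ : _ = egf (fps_texp ^ r * fps_exp 'X) n) //.
rewrite -egf_map texp_expz rmorphM /= fps_map_e1tX // fps_map_exp //=.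
by rewrite comp_polyX.
Qed.

Lemma polyA_recurrence r k n :
  polyA F r k n.+1 =
    - ('X * (polyA F r k n \Po ('X + 1)))
    + r%:~R * (\sum_(0 <= m < n.+1) \sum_(0 <= l < m.+1) \sum_(0 <= a < (m - l).+1)
        ((-1) ^+ a * 'C(m, l)%:R * 'C(m - l, a)%:R
           / (a.+2%:R * a.+1%:R * l.+1%:R ^ k) * (stirling1 n m)%:~R)
        *: (polyB F (1 - r) (m - l - a) \Po (- 'X)))
    + \sum_(0 <= m < n.+1) \sum_(0 <= a < m.+1)
        ('C(m, a)%:R * (stirling1 n m)%:~R / a.+2%:R ^ k)
        *: (polyB F (- r) (m - a) \Po (- 'X - 1)).
Proof.
(* Raising the index is differentiation; the chain rule contributes e^(-u), which is moved inside
   the composition. *)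
rewrite polyAE -egf_deriv fps_deriv_comp // fps_deriv_log1E // -fps_compM //.
rewrite deriv_polyA_egf // !fps_compD !egfD; congr (_ + _ + _).
- by rewrite fps_compM // fps_comp_const egf_constM comp_polyA mulNr.
- rewrite -(rmorph_int (@fps_const _)) fps_compM // fps_comp_const egf_constM.
  rewrite egf_comp_log1 //; congr (_ * _); apply: eq_bigr => m _.
  rewrite egfM mulr_sumr; apply: eq_bigr => l _.
  rewrite egfM !mulr_sumr; apply: eq_bigr => a _.
  (* Lif_k and E' e^(-u) have constant coefficients; exhibiting them as images under [polyC] makes
     these coefficients scalars of F. *)
  rewrite comp_polyB opprB -(fps_map_Lif (@polyC F)) // -[-1](rmorphN1 (@polyC F)).
  rewrite -(fps_map_exp (@polyC F)) // -!fps_map_divt !egf_map egf_Lif //.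
  rewrite egf_divt2_expN1 // -mul_polyC.
  rewrite invfM !rmorphM /= !rmorph_nat !rmorph_int; ring.
- rewrite egf_comp_log1 //; apply: eq_bigr => m _.
  rewrite egfM mulr_sumr; apply: eq_bigr => a _.
  (* The derivative of Lif_k shifts its index by one, so (a+1)^k becomes (a+2)^k. *)
  rewrite comp_polyB opprK egf_deriv -(fps_map_Lif (@polyC F)) // egf_map.
  rewrite egf_Lif // -mul_polyC.
  rewrite !rmorphM /= !rmorph_nat !rmorph_int; ring.
Qed.

End PolyAB.

Theorem theorem2p3 (R : realType) (r k : int) (n : nat) :
  polyA R[i] r k n.+1 =
    - ('X * (polyA R[i] r k n \Po ('X + 1)))
    + r%:~R * (\sum_(0 <= m < n.+1) \sum_(0 <= l < m.+1) \sum_(0 <= a < (m - l).+1)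
        ((-1) ^+ a * 'C(m, l)%:R * 'C(m - l, a)%:R
           / (a.+2%:R * a.+1%:R * l.+1%:R ^ k) * (stirling1 n m)%:~R)
        *: (polyB R[i] (1 - r) (m - l - a) \Po (- 'X)))
    + \sum_(0 <= m < n.+1) \sum_(0 <= a < m.+1)
        ('C(m, a)%:R * (stirling1 n m)%:~R / a.+2%:R ^ k)
        *: (polyB R[i] (- r) (m - a) \Po (- 'X - 1)).
Proof. by apply: polyA_recurrence => m; rewrite Num.Theory.pnatr_eq0. Qed.
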